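(* Let $n\ge 1$, let $f:\mathbb{R}^n\to\mathbb{R}^n$ be a super-linearizable polynomial vector field, and let $\psi:\mathbb{R}^n\to\mathbb{R}^n$ be a stably tame automorphism. Then the polynomial vector field $h(y) = D\psi_{\psi^{-1}(y)}\, f(\psi^{-1}(y))$, obtained from $\dot x = f(x)$ by the change of variables $y=\psi(x)$, is super-linearizable.
   Context: For a vector field $f$ on $\mathbb{R}^n$, $e^{tf}x_0$ denotes the value at time $t$ of the solution of $\dot x = f(x)$, $x(0)=x_0$. For $m\ge n$, $\Pi_n:\mathbb{R}^m\to\mathbb{R}^n$ is the projection on the first $n$ coordinates. $D\psi_x$ is the Jacobian matrix of $\psi$ at $x$. Super-linearizable: a polynomial vector field $f:\mathbb{R}^n\to\mathbb{R}^n$ is super-linearizable if there exist $k$, a polynomial map $p:\mathbb{R}^n\to\mathbb{R}^k$ and a matrix $A\in\mathbb{R}^{(n+k)\times(n+k)}$ such that for all $x_0\in\mathbb{R}^n$ and all $t\ge 0$, $\Pi_n(e^{At}z_0)=e^{tf}x_0$, where $z_0=(x_0,p(x_0))$ (in particular solutions of $\dot x=f(x)$ exist for all $t\ge 0$). A polynomial automorphism of $\mathbb{R}^n$ is a polynomial bijection $\mathbb{R}^n\to\mathbb{R}^n$ with polynomial inverse. An affine transformation is a map $x\mapsto Ax+b$ with $A$ an invertible real matrix. An elementary transformation of $\mathbb{R}^N$ is a map $x\mapsto (x_1,\ldots,x_{N-1},x_N+g(x_1,\ldots,x_{N-1}))$ with $g$ a real polynomial of degree greater than 1. A tame automorphism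 of $\mathbb{R}^N$ is a finite composition of affine and elementary transformations of $\mathbb{R}^N$. A polynomial automorphism $\psi:\mathbb{R}^n\to\mathbb{R}^n$ is stably tame if there exist $m>0$, a tame automorphism $\phi:\mathbb{R}^{n+m}\to\mathbb{R}^{n+m}$ and a polynomial map $y:\mathbb{R}^n\to\mathbb{R}^m$ such that $\Pi_n(\phi(x,y(x)))=\psi(x)$ for all $x\in\mathbb{R}^n$. *)

(* Defs.v *)
From mathcomp Require Import all_boot all_order all_algebra.
From mathcomp Require Import all_classical all_reals all_analysis.
(* The notations of mpoly clash with those of mathcomp-analysis. *)
From mathcomp Require mpoly.
Import -(notations) mpoly.
Import numFieldNormedType.Exports.
Set Implicit Arguments.
Unset Strict Implicit.
Unset Printing Implicit Defensive.
Import Order.TTheory GRing.Theory Num.Theory.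
Local Open Scope ring_scope.
Local Open Scope classical_set_scope.

Section Definitions.
Variable R : realType.

Definition meval_cV n (p : mpoly n R) (x : 'cV[R]_n) : R :=
  meval (fun i => x i 0) p.

Definition polynomial_map n k (f : 'cV[R]_n -> 'cV[R]_k) : Prop :=
  exists p : 'I_k -> mpoly n R, forall x i, f x i 0 = meval_cV (p i) x.

Definition expmx N (A : 'M[R]_N) : 'M[R]_N :=
  limn (series (fun k => (k`!%:R)^-1 *: A ^+ k)).

(* Forward solutions only: [x] is unconstrained at negative times, except that
   it is differentiable at 0, which is harmless since a solution on [0, +oo[
   always extends (affinely) to the left of 0. *)
Definition solution n (f : 'cV[R]_n -> 'cV[R]_n) (x0 : 'cV[R]_n)
    (x : R -> 'cV[R]_n) : Prop :=
  x 0 = x0 /\ forall t : R, 0 <= t -> is_derive t 1 x (f (x t)).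

(* [x] is e^{tf} x0; it is unique on [0, +oo[ because polynomial vector fields
   are locally Lipschitz.  Pi_n is [usubmx]. *)
Definition super_linearizable n (f : 'cV[R]_n -> 'cV[R]_n) : Prop :=
  polynomial_map f /\
  exists (k : nat) (p : 'cV[R]_n -> 'cV[R]_k) (A : 'M[R]_(n + k)),
    polynomial_map p /\
    forall x0 : 'cV[R]_n, exists x : R -> 'cV[R]_n, solution f x0 x /\
      forall t : R, 0 <= t ->
        usubmx (expmx (t *: A) *m col_mx x0 (p x0)) = x t.

Definition polynomial_automorphism n (psi : 'cV[R]_n -> 'cV[R]_n) : Prop :=
  polynomial_map psi /\
  exists phi : 'cV[R]_n -> 'cV[R]_n,
    [/\ polynomial_map phi, cancel psi phi & cancel phi psi].

Definition affine_transformation N (phi : 'cV[R]_N -> 'cV[R]_N) : Prop :=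
  exists (A : 'M[R]_N) (b : 'cV[R]_N),
    A \in unitmx /\ forall x, phi x = A *m x + b.

(* [msize g] is the degree of [g] plus one.  For N <= 1 there is no such [g]. *)
Definition elementary_transformation N (phi : 'cV[R]_N -> 'cV[R]_N) : Prop :=
  exists g : mpoly N.-1 R, (2 < mpoly.msize g)%N /\
    forall x i, phi x i 0 =
      if i == N.-1 :> nat
      then x i 0 + meval (fun j => x (widen_ord (leq_pred N) j) 0) g
      else x i 0.

Inductive tame_automorphism N : ('cV[R]_N -> 'cV[R]_N) -> Prop :=
| tame_affine phi : affine_transformation phi -> tame_automorphism phi
| tame_elementary phi :
    elementary_transformation phi -> tame_automorphism phi
| tame_comp phi1 phi2 : tame_automorphism phi1 -> tame_automorphism phi2 ->
    tame_automorphism (phi1 \o phi2).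

Definition stably_tame n (psi : 'cV[R]_n -> 'cV[R]_n) : Prop :=
  polynomial_automorphism psi /\
  exists (m : nat) (phi : 'cV[R]_(n + m) -> 'cV[R]_(n + m))
      (y : 'cV[R]_n -> 'cV[R]_m),
    [/\ (0 < m)%N, tame_automorphism phi, polynomial_map y &
        forall x, usubmx (phi (col_mx x (y x))) = psi x].

(* The library's jacobian acts on row vectors. *)
Definition jacobian_cV n m (psi : 'cV[R]_n -> 'cV[R]_m) (x : 'cV[R]_n) :
    'M[R]_(m, n) :=
  \matrix_(i, j) 'D_(delta_mx j 0) (fun z : 'cV[R]_n => psi z i 0) x.

End Definitions.

(* Main.v *)
(* Along the flow of a super-linearizable field the state is a linear image of
   e^{tA} z(x), with z polynomial in the initial point x.  Functions of the form
   c^T e^{tB} q(x), with q polynomial, form an algebra (direct sums of the linear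
   systems give sums, tensor products give products), so psi evaluated along the
   flow is again C e^{tB} q(x), with x = psi^{-1}(y0).  The linear system
   u' = C B w, w' = B w with initial value (y0, q(psi^{-1}(y0))) then has
   u = C w, which is the solution of the transformed field. *)
Require Import Defs.
From mathcomp Require Import all_boot all_order all_algebra.
From mathcomp Require Import all_classical all_reals all_analysis.
From mathcomp Require mpoly.
From mathcomp Require Import ring.
Import Order.TTheory GRing.Theory Num.Theory.
Import numFieldNormedType.Exports.
Import -(notations) mpoly.
Set Implicit Arguments.
Unset Strict Implicit.
Local Open Scope ring_scope.
Local Open Scope classical_set_scope.

(** * The matrix exponential as entrywise power series, and uniqueness for linear systems *)

Section MatrixExponential.
Context {R : realType}.

(** Coefficients of the power series in t of the (i, j) entry of A^m e^{tA}. The shift [m] makes the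
    family stable under formal differentiation. *)
Definition expmx_coef {N : nat} (A : 'M[R]_N) (m : nat) (i j : 'I_N) : R^nat :=
  fun k => (k`!%:R)^-1 * (A ^+ (m + k)%N) i j.

Lemma normr_expmx_entry_le (N : nat) (A : 'M[R]_N) (k : nat) (i j : 'I_N) :
  `|(A ^+ k) i j| <= (\sum_l \sum_h `|A l h|) ^+ k.
Proof.
have s0 : 0 <= \sum_l \sum_h `|A l h| by do 2! apply: sumr_ge0 => ? _.
elim: k i j => [|k IH] i j.
  by rewrite !expr0 mxE; case: eqP => _; rewrite ?normr1 ?normr0.
rewrite exprSr -mulmxE mxE (le_trans (ler_norm_sum _ _ _))//.
apply: (@le_trans _ _ (\sum_l (\sum_l \sum_h `|A l h|) ^+ k * `|A l j|)).
  by apply: ler_sum => l _; rewrite normrM ler_wpM2r.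
rewrite -mulr_sumr exprSr ler_wpM2l ?exprn_ge0//.
apply: ler_sum => l _; rewrite (bigD1 j)//= lerDl.
exact: sumr_ge0.
Qed.

(** Absolute convergence by comparison with a^m times the exponential series at a|x|, where a is the
    sum of the absolute values of the entries of [A]. *)
Lemma is_cvg_expmx_coef (N : nat) (A : 'M[R]_N) m (i j : 'I_N) (x : R) :
  cvgn (pseries (expmx_coef A m i j) x).
Proof.
set a := \sum_l \sum_h `|A l h|.
have a0 : 0 <= a by do 2! apply: sumr_ge0 => ? _.
apply: normed_cvg.
have := is_cvg_seriesZ (k := a ^+ m) (@is_cvg_series_exp_coeff R (a * `|x|)).
apply: series_le_cvg => k //=.
  by rewrite !mulr_ge0 ?exprn_ge0 ?mulr_ge0 ?invr_ge0.
rewrite /expmx_coef !normrM normfV normr_nat normrX.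
rewrite [leRHS](_ : _ = (k`!%:R)^-1 * (a ^+ (m + k) * `|x| ^+ k)); last first.
  rewrite -[LHS]/(a ^+ m * ((a * `|x|) ^+ k / k`!%:R)) exprMn exprD.
  by ring.
rewrite -mulrA ler_wpM2l ?invr_ge0// ler_wpM2r ?exprn_ge0//.
exact: normr_expmx_entry_le.
Qed.

Lemma pseries_diffs_expmx_coef (N : nat) (A : 'M[R]_N) m (i j : 'I_N) :
  pseries_diffs (expmx_coef A m i j) = expmx_coef A m.+1 i j.
Proof.
apply/funext => k; rewrite /pseries_diffs /expmx_coef factS natrM invfM.
by rewrite !mulrA divff// mul1r addSnnS.
Qed.

Lemma exprZmx (N : nat) (A : 'M[R]_N) (t : R) k :
  (t *: A) ^+ k = t ^+ k *: A ^+ k.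
Proof.
elim: k => [|k IH]; first by rewrite !expr0 scale1r.
by rewrite !exprS -!mulmxE IH -scalemxAl -scalemxAr scalerA.
Qed.

(** The matrix norm is the maximum of the entries and there are finitely many of them, so entrywise
    convergence gives convergence of matrices. *)
Lemma expmx_entry (N : nat) (A : 'M[R]_N) (t : R) (i j : 'I_N) :
  expmx (t *: A) i j = limn (pseries (expmx_coef A 0 i j) t).
Proof.
pose L := \matrix_(i, j) limn (pseries (expmx_coef A 0 i j) t).
suff -> : expmx (t *: A) = L by rewrite mxE.
apply/cvg_lim => //; apply/cvgrPdist_le => e e0.
near=> k.
rewrite /Num.Def.normr/= mx_normrE (bigmax_le _ (ltW e0))//= => ij _.
rewrite !mxE summxE.
under [X in _ - X]eq_bigr do rewrite exprZmx !mxE mulrCA mulrC.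
move: ij; near: k; apply: filter_forall => -[a b] /=.
exact: ((cvgrPdist_le _ _).1 (@is_cvg_expmx_coef N A 0 a b t)).
Unshelve. all: by end_near. Qed.

Lemma expmx0 (N : nat) : expmx (0 : 'M[R]_N) = 1%:M.
Proof.
apply/cvg_lim => //; apply/cvgrPdist_le => e e0.
near=> k.
suff -> : series (fun k => (k`!%:R)^-1 *: (0 : 'M[R]_N) ^+ k) k = 1%:M.
  by rewrite subrr normr0 ltW.
(* The partial sum of index 0 is empty; from index 1 on it contains the term of exponent 0, the only
   nonzero one. *)
rewrite /series/= -(@prednK k); last by near: k; exact: nbhs_infty_gt.
rewrite big_nat_recl// expr0 fact0 invr1 scale1r big1 ?addr0// => l _.
by rewrite exprS mul0r scaler0.
Unshelve. all: by end_near. Qed.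

Lemma limn_expmx_coefSl (N : nat) (A : 'M[R]_N) (t : R) (i j : 'I_N) :
  limn (pseries (expmx_coef A 1 i j) t) = (A *m expmx (t *: A)) i j.
Proof.
rewrite mxE; under eq_bigr do rewrite expmx_entry.
have -> : pseries (expmx_coef A 1 i j) t =
    fun n => \sum_l A i l * pseries (expmx_coef A 0 l j) t n.
  apply/funext => n; rewrite /pseries /series /=.
  under eq_bigr => k _.
    rewrite /expmx_coef exprS -mulmxE mxE mulr_sumr mulr_suml; over.
  rewrite exchange_big; apply: eq_bigr => l _; rewrite mulr_sumr.
  by apply: eq_bigr => k _; rewrite /expmx_coef -!mulrA mulrCA.
apply/cvg_lim => //; apply: cvg_big => [|l _]; first exact: add_continuous.
by apply: cvgM; [exact: cvg_cst|exact: is_cvg_expmx_coef].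
Qed.


(** Here a factor [A] is split off each power on the right. The left form differentiates a flow;
    this one differentiates e^{(T-s)A} in front of a solution, where the factors must meet in the
    middle to cancel. *)
Lemma limn_expmx_coefSr (N : nat) (A : 'M[R]_N) (t : R) (i j : 'I_N) :
  limn (pseries (expmx_coef A 1 i j) t) = (expmx (t *: A) *m A) i j.
Proof.
rewrite mxE; under eq_bigr do rewrite expmx_entry.
have -> : pseries (expmx_coef A 1 i j) t =
    fun n => \sum_l pseries (expmx_coef A 0 i l) t n * A l j.
  apply/funext => n; rewrite /pseries /series /=.
  under eq_bigr => k _.
    rewrite /expmx_coef add1n exprSr -mulmxE mxE mulr_sumr mulr_suml; over.
  rewrite exchange_big; apply: eq_bigr => l _; rewrite mulr_suml.
  by apply: eq_bigr => k _; rewrite /expmx_coef; ring.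
apply/cvg_lim => //; apply: cvg_big => [|l _]; first exact: add_continuous.
by apply: cvgM; [exact: is_cvg_expmx_coef|exact: cvg_cst].
Qed.

Lemma is_derive_expmx_entry (N : nat) (A : 'M[R]_N) (t : R) (i j : 'I_N) :
  is_derive t 1 (fun t => expmx (t *: A) i j)
    (limn (pseries (expmx_coef A 1 i j) t)).
Proof.
under eq_fun do rewrite expmx_entry.
rewrite -pseries_diffs_expmx_coef.
(* Any point of modulus greater than |t| would do: the series and its first two formal derivatives
   converge everywhere. *)
apply: (@pseries_snd_diffs _ _ (`|t| + 1)); rewrite ?pseries_diffs_expmx_coef;
  try exact: is_cvg_expmx_coef.
by rewrite [ltRHS]ger0_norm ?ltrDl// addr_ge0.
Qed.

Lemma is_derive_expmx_mul (N : nat) (A : 'M[R]_N) (z : 'cV[R]_N) (t : R) i :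
  is_derive t 1 (fun t => (expmx (t *: A) *m z) i 0)
    ((A *m (expmx (t *: A) *m z)) i 0).
Proof.
under eq_fun do rewrite mxE.
rewrite (_ : (fun _ => _) =
  \sum_l (z l 0 *: (fun t => expmx (t *: A) i l))); last first.
  by apply/funext => s; rewrite fct_sumE; apply: eq_bigr => l _; rewrite mulrC.
rewrite mulmxA mxE; apply: is_derive_sum => l.
apply: is_derive_eq; first exact/is_deriveZ/is_derive_expmx_entry.
by rewrite limn_expmx_coefSl mulrC.
Qed.

(* For fixed T, the curve s |-> e^{(T-s)B} w(s) is constant. *)
Lemma linear_ode_expmx (N : nat) (B : 'M[R]_N) (w : R -> 'cV[R]_N) :
  (forall (t : R) i, is_derive t 1 (fun t => w t i 0) ((B *m w t) i 0)) ->
  forall t, w t = expmx (t *: B) *m w 0.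
Proof.
move=> dw T; apply/colP => i.
pose g s := (expmx ((T - s) *: B) *m w s) i 0.
suff : g T = g 0 by rewrite /g subrr scale0r expmx0 mul1mx subr0.
apply: is_derive_0_is_cst => s.
rewrite (_ : g = \sum_l
    ((fun s => expmx (s *: B) i l) \o (fun s => T - s)) * (fun s => w s l 0));
  last first.
  by apply/funext => u; rewrite fct_sumE /g mxE.
have dT : is_derive s 1 (fun s => T - s) (- 1).
  exact: is_derive_eq (is_deriveB (f := cst T) (g := id) _ _) (sub0r _).
apply: is_derive_eq.
  apply: is_derive_sum => l; apply: is_deriveM => //.
  exact: (is_derive1_comp (is_derive_expmx_entry _ _ _ _) dT).
transitivity ((expmx ((T - s) *: B) *m (B *m w s)
               - expmx ((T - s) *: B) *m B *m w s) i 0).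
  rewrite !mxE -sumrB; apply: eq_bigr => l _.
  by rewrite limn_expmx_coefSr mulrN1 scalerN [in LHS]/GRing.scale /= mulrC
    [X in _ - X]mulrC.
by rewrite mulmxA subrr mxE.
Qed.

End MatrixExponential.

(** * Polynomial functions, their chain rule and the Jacobian *)

Section PolynomialFunctions.
Context {R : realType}.

(** A single induction over monomials, variables and exponents. Leaving [P] abstract lets it serve
    composition of polynomials, the chain rule and linear realizability alike. *)
Lemma meval_closed (T : Type) n (P : (T -> R) -> Prop) (G : 'I_n -> T -> R)
    (p : mpoly n R) :
  (forall c, P (fun=> c)) ->
  (forall f g, P f -> P g -> P (fun x => f x + g x)) ->
  (forall f g, P f -> P g -> P (fun x => f x * g x)) ->
  (forall i, P (G i)) -> P (fun x => meval (fun i => G i x) p).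
Proof.
move=> Pc Padd Pmul PG.
under eq_fun do rewrite mevalE.
elim: (msupp p) => [|m s IH].
  by under eq_fun do rewrite big_nil; exact: Pc.
under eq_fun do rewrite big_cons.
apply: (Padd) => //; apply: (Pmul) => //.
elim: (index_enum _) => [|i r IHr].
  by under eq_fun do rewrite big_nil; exact: Pc.
under eq_fun do rewrite big_cons.
apply: (Pmul) => //.
elim: (fun_of_multinom m i) => [|k IHk].
  by under eq_fun do rewrite expr0.
by under eq_fun do rewrite exprS; exact: Pmul.
Qed.

Definition polyfun n (g : 'cV[R]_n -> R) : Prop :=
  exists p : mpoly n R, forall x, g x = meval_cV p x.

Lemma polyfun_cst n (c : R) : polyfun (fun _ : 'cV[R]_n => c).
Proof. by exists (mpolyC n c) => x; rewrite /meval_cV mevalC. Qed.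

Lemma polyfun_coord n (i : 'I_n) : polyfun (fun x : 'cV[R]_n => x i 0).
Proof. by exists (mpolyX R (mnm1 i)) => x; rewrite /meval_cV mevalXU. Qed.

Lemma polyfunD n (f g : 'cV[R]_n -> R) :
  polyfun f -> polyfun g -> polyfun (fun x => f x + g x).
Proof.
move=> [p fp] [q gq]; exists (p + q) => x.
by rewrite fp gq /meval_cV mevalD.
Qed.

Lemma polyfunM n (f g : 'cV[R]_n -> R) :
  polyfun f -> polyfun g -> polyfun (fun x => f x * g x).
Proof.
move=> [p fp] [q gq]; exists (p * q) => x.
by rewrite fp gq /meval_cV mevalM.
Qed.

Lemma polyfun_sum n (I : Type) (r : seq I) (f : I -> 'cV[R]_n -> R) :
  (forall i, polyfun (f i)) -> polyfun (fun x => \sum_(i <- r) f i x).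
Proof.
move=> pf; elim: r => [|i r IH].
  by under eq_fun do rewrite big_nil; exact: polyfun_cst.
by under eq_fun do rewrite big_cons; exact: polyfunD.
Qed.

Lemma polynomial_mapP n k (f : 'cV[R]_n -> 'cV[R]_k) :
  polynomial_map f <-> forall i, polyfun (fun x => f x i 0).
Proof.
split=> [[p fp] i|pf]; first by exists (p i).
by have [p fp] := choice pf; exists p.
Qed.

Lemma polyfun_comp n k (g : 'cV[R]_k -> R) (f : 'cV[R]_n -> 'cV[R]_k) :
  polyfun g -> polynomial_map f -> polyfun (fun x => g (f x)).
Proof.
move=> [p gp] /polynomial_mapP pf; under eq_fun do rewrite gp /meval_cV.
by apply: meval_closed => //;
  [exact: polyfun_cst|exact: polyfunD|exact: polyfunM].
Qed.

Lemma is_derive_cV n (x : R -> 'cV[R]_n) (t : R) (v : 'cV[R]_n) :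
  is_derive t 1 x v <-> forall i, is_derive t 1 (fun t => x t i 0) (v i 0).
Proof.
split=> [[dx xv] i|dx].
  split; first exact: (derivable_mxP _ _ _).1.
  by rewrite -xv derive_mx// mxE.
have dx' : derivable x t 1.
  by apply/derivable_mxP => i j; rewrite ord1; case: (dx i).
split=> //; apply/colP => i; rewrite derive_mx// mxE.
exact: derive_val.
Qed.

Lemma polyfun_chain_rule n (g : 'cV[R]_n -> R) : polyfun g ->
  exists dg : 'I_n -> 'cV[R]_n -> R, (forall j, polyfun (dg j)) /\
    forall (x : R -> 'cV[R]_n) (v : 'cV[R]_n) (t : R), is_derive t 1 x v ->
      is_derive t 1 (fun t => g (x t)) (\sum_j dg j (x t) * v j 0).
Proof.
move=> [p gp]; have -> : g = fun x => meval (fun i => x i 0) p by exact/funext.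
move: g gp => _ _.
(* Polynomiality of [g] is carried along in the induction because the partial derivatives of a
   product involve the factors themselves. *)
set P := fun g : 'cV[R]_n -> R => polyfun g /\
  exists dg : 'I_n -> 'cV[R]_n -> R, (forall j, polyfun (dg j)) /\
    forall (x : R -> 'cV[R]_n) (v : 'cV[R]_n) (t : R), is_derive t 1 x v ->
      is_derive t 1 (fun t => g (x t)) (\sum_j dg j (x t) * v j 0).
suff [] : P (fun x => meval (fun i => x i 0) p) by [].
apply: meval_closed => [c|f g [pf [df [pdf dfE]]] [pg [dg [pdg dgE]]]
  |f g [pf [df [pdf dfE]]] [pg [dg [pdg dgE]]]|i]; split.
- exact: polyfun_cst.
- exists (fun _ _ => 0); split=> [j|x v t _]; first exact: polyfun_cst.
  by rewrite big1 => [|j _]; [exact: is_derive_cst|rewrite mul0r].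
- exact: polyfunD.
- exists (fun j x => df j x + dg j x); split=> [j|x v t xv].
    exact: polyfunD.
  apply: (is_derive_eq (is_deriveD (dfE _ _ _ xv) (dgE _ _ _ xv))).
  by rewrite -big_split; apply: eq_bigr => j _; rewrite mulrDl.
- exact: polyfunM.
- exists (fun j x => f x * dg j x + g x * df j x); split=> [j|x v t xv].
    by apply: polyfunD; exact: polyfunM.
  apply: (is_derive_eq (is_deriveM (dfE _ _ _ xv) (dgE _ _ _ xv))).
  rewrite !scaler_sumr -big_split; apply: eq_bigr => j _.
  by rewrite mulrDl -!mulrA.
- exact: polyfun_coord.
- exists (fun j _ => (j == i)%:R); split=> [j|x v t /is_derive_cV xv].
    exact: polyfun_cst.
  apply: (is_derive_eq (xv i)).
  rewrite (bigD1 i)//= eqxx mul1r big1 ?addr0// => j /negPf ->.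
  by rewrite mul0r.
Qed.

Lemma jacobian_cV_chain_rule n m (psi : 'cV[R]_n -> 'cV[R]_m) :
  polynomial_map psi ->
  (forall i j, polyfun (fun x => jacobian_cV psi x i j)) /\
  forall (x : R -> 'cV[R]_n) (v : 'cV[R]_n) (t : R), is_derive t 1 x v ->
    is_derive t 1 (psi \o x) (jacobian_cV psi (x t) *m v).
Proof.
move=> /polynomial_mapP ppsi.
have /choice[dg dgP] := fun i => polyfun_chain_rule (ppsi i).
have jacE i j x : jacobian_cV psi x i j = dg i j x.
  rewrite mxE /derive.
  (* The chain rule along the line h |-> h e_j + x at h = 0 identifies [dg i j] with the directional
     derivative that defines the Jacobian entry. *)
  have [_ /(_ (fun h => h *: delta_mx j 0 + x) (delta_mx j 0) 0)] := dgP i.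
  case.
    apply/is_derive_cV => k.
    rewrite (_ : (fun _ => _) =
        (delta_mx j 0 : 'cV[R]_n) k 0 \*: id + cst (x k 0)).
      by apply: is_derive_eq; rewrite addr0 [_ *: _]mulr1.
    by apply/funext => h; rewrite !mxE mulrC.
  move=> _; rewrite /derive scale0r add0r (bigD1 j)//= mxE !eqxx mulr1 big1.
    rewrite addr0 => <-.
    have e (h : R) : h *: (1 : R) + 0 = h by rewrite addr0 [_ *: _]mulr1.
    by under [in RHS]eq_fun do rewrite e.
  by move=> k /negPf kj; rewrite mxE kj mulr0.
split=> [i j|x v t xv].
  by under eq_fun do rewrite jacE; exact: (dgP i).1.
apply/is_derive_cV => i; apply: (is_derive_eq ((dgP i).2 _ _ _ xv)).
by rewrite mxE; apply: eq_bigr => j _; rewrite jacE.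
Qed.

End PolynomialFunctions.

(** * The algebra of outputs of linear systems with polynomial initial data *)

Section LinearlyRealizable.
Context {R : realType}.

(* Equivalently, g (t, x) = c^T e^{tB} q(x) with q polynomial; arbitrary finite
   index types let sum and product types index direct sums and tensor products. *)
Definition linearly_realizable n (g : R * 'cV[R]_n -> R) : Prop :=
  exists (I : finType) (B : I -> I -> R) (c : I -> R)
      (W : I -> R -> 'cV[R]_n -> R),
    [/\ forall i, polyfun (W i 0),
        forall i (t : R) x,
          is_derive t 1 (fun t => W i t x) (\sum_j B i j * W j t x) &
        forall tx, g tx = \sum_i c i * W i tx.1 tx.2].

Lemma linearly_realizable_cst n (c : R) :
  linearly_realizable (fun _ : R * 'cV[R]_n => c).
Proof.
exists unit, (fun _ _ => 0), (fun=> 1), (fun _ _ _ => c); split => [_|_ t x|_].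
- exact: polyfun_cst.
- by rewrite big1 => [|? _]; [exact: is_derive_cst|rewrite mul0r].
- by rewrite (bigD1 tt)//= big1 ?mul1r ?addr0// => -[].
Qed.

Lemma linearly_realizableD n (f g : R * 'cV[R]_n -> R) :
  linearly_realizable f -> linearly_realizable g ->
  linearly_realizable (fun tx => f tx + g tx).
Proof.
move=> [I [B [b [V [V0 V' fE]]]]] [J [C [c [W [W0 W' gE]]]]].
exists (I + J)%type,
  (fun p q => match p, q with
    | inl i, inl j => B i j | inr i, inr j => C i j | _, _ => 0 end),
  (fun p => match p with inl i => b i | inr j => c j end),
  (fun p => match p with inl i => V i | inr j => W j end).
split=> [[i|j]//|[i|j] t x|tx].
- rewrite big_sumType /= [X in _ + X]big1 ?addr0// => k _.
  by rewrite mul0r.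
- rewrite big_sumType /= [X in X + _]big1 ?add0r// => k _.
  by rewrite mul0r.
- by rewrite big_sumType /= fE gE.
Qed.

(** By the Leibniz rule the products of states V_i W_j evolve under the Kronecker sum of [B] and
    [C], that is B (x) 1 + 1 (x) C. *)
Lemma linearly_realizableM n (f g : R * 'cV[R]_n -> R) :
  linearly_realizable f -> linearly_realizable g ->
  linearly_realizable (fun tx => f tx * g tx).
Proof.
move=> [I [B [b [V [V0 V' fE]]]]] [J [C [c [W [W0 W' gE]]]]].
exists (I * J)%type,
  (fun p q => B p.1 q.1 * (p.2 == q.2)%:R + (p.1 == q.1)%:R * C p.2 q.2),
  (fun p => b p.1 * c p.2), (fun p t x => V p.1 t x * W p.2 t x).
split=> [[i j]|[i j] t x|tx] /=.
- exact: polyfunM.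
- apply: (is_derive_eq (is_deriveM (V' i t x) (W' j t x))).
  rewrite -(pair_bigA _ (fun k l => (B i k * (j == l)%:R + (i == k)%:R * C j l)
     * (V k t x * W l t x))) /=.
  under [RHS]eq_bigr => k _.
    under eq_bigr do rewrite mulrDl.
    rewrite big_split /= (bigD1 j)//= eqxx mulr1 big1 ?addr0; last first.
      by move=> l /negPf lj; rewrite eq_sym lj mulr0 mul0r.
    over.
  rewrite big_split /= addrC; congr (_ + _); last first.
    rewrite scaler_sumr; apply: eq_bigr => k _.
    by rewrite [LHS]mulrC -mulrA.
  rewrite (bigD1 i)//= [X in _ = _ + X]big1 ?addr0.
    rewrite scaler_sumr; apply: eq_bigr => l _.
    by rewrite eqxx mul1r [LHS]mulrCA.
  move=> k /negPf ki; rewrite big1// => l _.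
  by rewrite eq_sym ki !mul0r.
- rewrite fE gE big_distrlr /= pair_bigA; apply: eq_bigr => -[k l] _ /=.
  by rewrite mulrACA.
Qed.

Lemma linearly_realizable_expmx n N (A : 'M[R]_N) (q : 'cV[R]_n -> 'cV[R]_N) i :
  polynomial_map q ->
  linearly_realizable (fun tx => (expmx (tx.1 *: A) *m q tx.2) i 0).
Proof.
move=> /polynomial_mapP pq.
exists 'I_N, (fun i j => A i j), (fun j => (j == i)%:R),
  (fun i t x => (expmx (t *: A) *m q x) i 0); split=> [j|j t x|tx].
- by under eq_fun do rewrite scale0r expmx0 mul1mx.
- by have := is_derive_expmx_mul A (q x) t j; rewrite [X in _ 1 _ X]mxE.
- rewrite (bigD1 i)//= eqxx mul1r big1 ?addr0// => j /negPf ->.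
  by rewrite mul0r.
Qed.

(** The m realizations are stacked into one block-diagonal system, indexed by an enumeration of the
    disjoint union of their index types. Uniqueness for linear systems then writes the stacked state
    as an exponential applied to its value at time 0. *)
Lemma linearly_realizable_expmx_flow n m (g : 'I_m -> R * 'cV[R]_n -> R) :
  (forall i, linearly_realizable (g i)) ->
  exists K (B : 'M[R]_K) (C : 'M[R]_(m, K)) (q : 'cV[R]_n -> 'cV[R]_K),
    polynomial_map q /\
    forall t x, \col_i g i (t, x) = C *m (expmx (t *: B) *m q x).
Proof.
move=> realg; have /all_sig[I {}realg] := fun i => cid (realg i).
have /all_sig[B {}realg] := fun i => cid (realg i).
have /all_sig[c {}realg] := fun i => cid (realg i).
have /all_sig[W gP] := fun i => cid (realg i).
pose J : finType := {i : 'I_m & I i}.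
(* Block-diagonal coefficients: [tagged_as] transports the second index into the fiber of the first
   when the tags agree. *)
pose BJ (p r : J) :=
  if tag p == tag r then B (tag p) (tagged p) (tagged_as p r) else 0.
pose BM := \matrix_(k < #|J|, l < #|J|) BJ (enum_val k) (enum_val l).
pose CM := \matrix_(i < m, k < #|J|)
  (if i == tag (enum_val k) :> 'I_m then c _ (tagged (enum_val k)) else 0).
pose w t x := \col_(k < #|J|) W _ (tagged (enum_val k)) t x.
have wE t x : w t x = expmx (t *: BM) *m w 0 x.
  apply: (linear_ode_expmx (w := w ^~ x)) => {}t k.
  under eq_fun do rewrite mxE.
  have [_ W' _] := gP (tag (enum_val k)).
  apply: (is_derive_eq (W' _ t x)).
  rewrite mxE; under [RHS]eq_bigr do rewrite !mxE.
  rewrite -(big_enum_val (fun r =>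
    BJ (enum_val k) r * W (tag r) (tagged r) t x)) /=.
  pose F i j := BJ (enum_val k) (Tagged I (j : I i)) * W i j t x.
  (* The sum is split into fibers, of which only the one over the tag of the current index
     contributes. *)
  rewrite [RHS](_ : _ = \sum_i \sum_(j : I i) F i j); last first.
    by rewrite sig_big_dep; apply: eq_bigr => -[].
  rewrite (bigD1 (tag (enum_val k)))//= [X in _ = _ + X]big1 ?addr0.
    by apply: eq_bigr => j _; rewrite /F /BJ /= eqxx tagged_asE.
  move=> i /negPf ik; rewrite big1// => j _.
  by rewrite /F /BJ /= eq_sym ik mul0r.
exists #|J|, BM, CM, (w 0); split=> [|t x].
  apply/polynomial_mapP => k; under eq_fun do rewrite mxE.
  by have [+ _ _] := gP (tag (enum_val k)); exact.
rewrite -wE; apply/colP => i; rewrite !mxE.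
under eq_bigr do rewrite !mxE.
pose F i' j := (if i == i' then c i' j else 0) * W i' j t x.
rewrite -(big_enum_val (fun r : J => F (tag r) (tagged r))) /=.
rewrite [RHS](_ : _ = \sum_k \sum_(l : I k) F k l); last first.
  by rewrite sig_big_dep; apply: eq_bigl.
rewrite (bigD1 i)//= [X in _ = _ + X]big1 ?addr0.
  have [_ _ ->] := gP i; by apply: eq_bigr => j _; rewrite /F eqxx.
by move=> k /negPf ik; rewrite big1// => j _; rewrite /F eq_sym ik mul0r.
Qed.

(** With w = e^{tB} q, the pair (C w, w) solves the block system, so uniqueness applies. This turns
    a linear output into leading coordinates of the state, as super-linearizability demands. *)
Lemma expmx_embed_output m K (B : 'M[R]_K) (C : 'M[R]_(m, K)) (q : 'cV[R]_K) t :
  usubmx (expmx (t *: block_mx 0 (C *m B) 0 B) *m col_mx (C *m q) q) =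
  C *m (expmx (t *: B) *m q).
Proof.
pose w t := col_mx (C *m (expmx (t *: B) *m q)) (expmx (t *: B) *m q).
have w0 : w 0 = col_mx (C *m q) q by rewrite /w scale0r expmx0 mul1mx.
suff /linear_ode_expmx/(_ t) wE : forall (t : R) i, is_derive t 1
    (fun t => w t i 0) ((block_mx 0 (C *m B) 0 B *m w t) i 0).
  by rewrite -w0 -wE col_mxKu.
move=> {}t i.
rewrite /w mul_block_col !mul0mx !add0r.
case: (split_ordP i) => j ->.
  rewrite col_mxEu; under eq_fun do rewrite col_mxEu mxE.
  rewrite (_ : (fun _ => _) =
    \sum_l (C j l *: (fun t => (expmx (t *: B) *m q) l 0))); last first.
    by apply/funext => s; rewrite fct_sumE.
  rewrite -mulmxA mxE; apply: is_derive_sum => l.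
  exact/is_deriveZ/is_derive_expmx_mul.
rewrite col_mxEd; under eq_fun do rewrite col_mxEd.
exact: is_derive_expmx_mul.
Qed.

End LinearlyRealizable.

(** * Transport of the linear lift along the automorphism *)

Unset Implicit Arguments.

Theorem corollary2p2 (R : realType) (n : nat) (hn : (1 <= n)%N)
    (f psi psiV : 'cV[R]_n -> 'cV[R]_n)
    (hf : super_linearizable f) (hpsi : stably_tame psi)
    (psiK : cancel psi psiV) (psiVK : cancel psiV psi) :
  super_linearizable (fun y => jacobian_cV psi (psiV y) *m f (psiV y)).
Proof.
have [[ppsi [phi [pphi psiphi _]]] _] := hpsi.
(* Inverses are unique, so the given [psiV] is the polynomial inverse supplied by the
   automorphism. *)
have ppsiV : polynomial_map psiV.
  by rewrite (_ : psiV = phi)//; apply/funext => y;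
    rewrite -[y in RHS]psiVK psiphi.
have [jac_poly jac_chain] := jacobian_cV_chain_rule ppsi.
have [pf [k [p [A [pp flow]]]]] := hf.
have pz : polynomial_map (fun x => col_mx x (p x)).
  apply/polynomial_mapP => i; case: (split_ordP i) => j ->.
    by under eq_fun do rewrite col_mxEu; exact: polyfun_coord.
  by under eq_fun do rewrite col_mxEd; exact: (polynomial_mapP p).1.
(* For t >= 0 this is the flow of [f]; the formula makes sense for every real t, which the two-sided
   notion of realizability requires. *)
pose z t x := usubmx (expmx (t *: A) *m col_mx x (p x)).
have /linearly_realizable_expmx_flow[K [B [C [q [pq psiz]]]]] :
    forall i, linearly_realizable (fun tx => psi (z tx.1 tx.2) i 0).
  move: ppsi => [P psiP] i; under eq_fun do rewrite psiP /meval_cV.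
  apply: meval_closed => [c|g h|g h|j].
  - exact: linearly_realizable_cst.
  - exact: linearly_realizableD.
  - exact: linearly_realizableM.
  - under eq_fun do rewrite /z mxE.
    exact: (linearly_realizable_expmx A (lshift k j) pz).
have {}psiz t x : psi (z t x) = C *m (expmx (t *: B) *m q x).
  by rewrite -psiz; apply/colP => i; rewrite mxE.
split.
  apply/polynomial_mapP => i; under eq_fun do rewrite mxE.
  apply: polyfun_sum => j; apply: polyfunM.
    exact: (polyfun_comp (jac_poly i j)).
  apply: (polyfun_comp (g := fun x => f x j 0)) => //.
  exact: (polynomial_mapP f).1.
(* The lift at y0 is the initial state [q] at the preimage of y0; the block matrix carries the
   output C w as its first coordinates. *)
exists K, (q \o psiV), (block_mx 0 (C *m B) 0 B); split=> [|y0].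
  move: pq => /polynomial_mapP pq; apply/polynomial_mapP => i.
  exact: (polyfun_comp (pq i)).
have [x [[x0 x'] xE]] := flow (psiV y0).
exists (psi \o x); split; first split; rewrite /= ?x0 ?psiVK//.
  move=> t t0; rewrite psiK; exact: jac_chain (x' t t0).
move=> t t0; rewrite -xE// -/(z _ _) psiz -expmx_embed_output.
(* The required initial vector has y0 on top, whereas the embedding starts at C q; evaluating [psiz]
   at time 0 shows that they agree. *)
suff -> : C *m q (psiV y0) = y0 by [].
have := psiz 0 (psiV y0); rewrite scale0r expmx0 mul1mx => <-.
by rewrite /z scale0r expmx0 mul1mx col_mxKu psiVK.
Qed.
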